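(* Let $p \neq 3$ be a prime, let $\epsilon>0$ and let $n>0$ be an integer. If $\|p^n\|_{\log} \geq 3+\epsilon$, then $S_3(p^n) \geq n\,\epsilon \log_3 p$.
   Context: For a positive integer $m$, $\|m\|$ (the integer complexity of $m$) denotes the minimum number of occurrences of the constant $1$ in an arithmetic expression built only from the constant $1$, addition, multiplication and parentheses whose value is $m$. For $m>1$, the logarithmic complexity is $\|m\|_{\log} = \|m\|/\log_3 m$. For an integer base $q \ge 2$, $S_q(m)$ denotes the sum of the digits of the canonical base-$q$ representation of $m$. *)

(* Defs.v *)
From HB Require Import structures.
From mathcomp Require Import all_boot all_order all_algebra.
From mathcomp Require Import boolp reals exp.

Set Implicit Arguments.
Unset Strict Implicit.
Unset Printing Implicit Defensive.

Import Order.TTheory GRing.Theory Num.Theory.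

Inductive arith_expr : Type :=
| One
| Add of arith_expr & arith_expr
| Mul of arith_expr & arith_expr.

Fixpoint value (e : arith_expr) : nat :=
  match e with
  | One => 1
  | Add a b => value a + value b
  | Mul a b => value a * value b
  end.

Fixpoint ones (e : arith_expr) : nat :=
  match e with
  | One => 1
  | Add a b => ones a + ones b
  | Mul a b => ones a + ones b
  end.

Definition expressible_with (m k : nat) : bool :=
  `[< exists2 e : arith_expr, value e = m & ones e = k >].

Lemma expressible_ex (m : nat) : 0 < m -> exists k, expressible_with m k.
Proof.
case: m => // m _; elim: m => [|m [k /asboolP[e em ek]]].
  by exists 1; apply/asboolP; exists One.
exists k.+1; apply/asboolP; exists (Add e One) => /=.
  by rewrite em addn1.
by rewrite ek addn1.
Qed.

(* The value at m = 0, which no expression represents, is the junk value 0. *)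
Definition complexity (m : nat) : nat :=
  match pselect (exists k, expressible_with m k) with
  | left ex => ex_minn ex
  | right _ => 0
  end.

Lemma complexity_attained (m : nat) : 0 < m ->
  exists2 e : arith_expr, value e = m & ones e = complexity m.
Proof.
move=> m0; rewrite /complexity; case: pselect => [ex|].
  by case: ex_minnP => k /asboolP.
by move=> /(_ (expressible_ex m0)).
Qed.

Lemma complexity_le (e : arith_expr) : complexity (value e) <= ones e.
Proof.
rewrite /complexity; case: pselect => // ex.
by case: ex_minnP => k _; apply; apply/asboolP; exists e.
Qed.

(* Least significant digit first. For 1 < q and 0 < m, trunc_log q m is the
   largest k with q ^ k <= m, that is, the position of the leading digit. *)
Definition digits (q m : nat) : seq nat :=
  [seq (m %/ q ^ i) %% q | i <- iota 0 (trunc_log q m).+1].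

Definition digit_sum (q m : nat) : nat := sumn (digits q m).

Local Open Scope ring_scope.

Definition log3 (R : realType) (x : R) : R := ln x / ln 3%:R.

(* Meaningful for 1 < m only; log3 1 = 0. *)
Definition log_complexity (R : realType) (m : nat) : R :=
  (complexity m)%:R / log3 m%:R.

(* Main.v *)
Require Import Defs.
From mathcomp Require Import all_boot all_order all_algebra.
From mathcomp Require Import boolp reals exp.

Import Order.TTheory GRing.Theory Num.Theory.

(** Evaluating the base-[q] expansion of [m] by Horner's scheme writes [m] with
    [q] ones for each multiplication by [q] and as many further ones as the
    digits sum to, so [complexity m <= q * k + digit_sum q m] with
    [k = trunc_log q m].  For [q = 3] the first term is at most [3 * log3 m]. *)

Lemma value_gt0 (e : arith_expr) : 0 < value e.
Proof.
elim: e => //= a a0 b b0; first by rewrite addn_gt0 a0.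
by rewrite muln_gt0 a0.
Qed.

Lemma complexity0 : complexity 0 = 0.
Proof.
rewrite /complexity; case: pselect => // ex; exfalso.
case: ex => k /asboolP[e e0 _].
by have := value_gt0 e; rewrite e0.
Qed.

(** Optimal expressions for both summands are joined by one [Add]. A zero summand has no expression,
    but there [a + b] is just the other summand. *)
Lemma complexity_add (a b : nat) :
  complexity (a + b) <= complexity a + complexity b.
Proof.
have [->|a0] := posnP a; first by rewrite add0n leq_addl.
have [->|b0] := posnP b; first by rewrite addn0 leq_addr.
have [ea <- <-] := complexity_attained a0.
have [eb <- <-] := complexity_attained b0.
exact: (complexity_le (Add ea eb)).
Qed.

Lemma complexity_mul (a b : nat) :
  complexity (a * b) <= complexity a + complexity b.
Proof.
have [->|a0] := posnP a; first by rewrite mul0n complexity0.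
have [->|b0] := posnP b; first by rewrite muln0 complexity0.
have [ea <- <-] := complexity_attained a0.
have [eb <- <-] := complexity_attained b0.
exact: (complexity_le (Mul ea eb)).
Qed.

Lemma complexity_le_id (m : nat) : complexity m <= m.
Proof.
elim: m => [|m IHm]; first by rewrite complexity0.
rewrite -addn1 (leq_trans (complexity_add _ _)) // leq_add //.
exact: (complexity_le One).
Qed.

Lemma trunc_log_divn (q m : nat) :
  1 < q -> q <= m -> trunc_log q m = (trunc_log q (m %/ q)).+1.
Proof.
move=> q1 qm; have q0 : 0 < q by apply: ltnW.
have mq0 : 0 < m %/ q by rewrite divn_gt0.
(* With [k = trunc_log q (m %/ q)], the bounds [q ^ k <= m %/ q < q ^ k.+1] become bounds on [m]
   once multiplied by [q]. *)
apply: trunc_log_eq => //; have /andP[lo hi] := trunc_log_bounds q1 mq0.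
by rewrite [X in X <= _]expnSr [X in _ < X]expnSr -leq_divRL // lo -ltn_divLR.
Qed.

Lemma digit_sum_small (q m : nat) : m < q -> digit_sum q m = m.
Proof.
move=> mq; rewrite /digit_sum /digits.
have /eqP -> : trunc_log q m == 0.
  by rewrite trunc_log_eq0; case: q mq => //= q; rewrite [m < _]ltnS orbC => ->.
by rewrite /= expn0 divn1 addn0 modn_small.
Qed.

Lemma digit_sum_divn (q m : nat) : 1 < q -> q <= m ->
  digit_sum q m = m %% q + digit_sum q (m %/ q).
Proof.
move=> q1 qm; rewrite /digit_sum /digits trunc_log_divn //.
move: (trunc_log q (m %/ q)).+1 => k.
rewrite /= expn0 divn1; congr (_ + sumn _).
(* Digit [i + 1] of [m] is digit [i] of [m %/ q]. *)
rewrite (iotaDl 1 0) -map_comp; apply: eq_map => i /=.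
by rewrite add1n expnS divnMA.
Qed.

Lemma complexity_le_digit_sum (q m : nat) : 1 < q ->
  complexity m <= q * trunc_log q m + digit_sum q m.
Proof.
move=> q1; elim/ltn_ind: m => m IHm.
have [mq|qm] := ltnP m q.
  by rewrite digit_sum_small // (leq_trans (complexity_le_id m)) ?leq_addl.
have m0 : 0 < m by apply: leq_trans qm; apply: ltnW.
(* One Horner step: [m = (m %/ q) * q + m %% q]. The last digit pays for the remainder; the unit by
   which [trunc_log] drops pays the [q] ones for the factor [q]. *)
rewrite trunc_log_divn // digit_sum_divn // {1}(divn_eq m q).
rewrite (leq_trans (complexity_add _ _)) //.
rewrite addnCA [X in X <= _]addnC leq_add ?complexity_le_id //.
rewrite (leq_trans (complexity_mul _ _)) // mulnS [X in X <= _]addnC -addnA.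
by rewrite leq_add ?complexity_le_id // IHm // ltn_Pdiv.
Qed.

Local Open Scope ring_scope.

Lemma ln3_gt0 (R : realType) : 0 < ln 3%:R :> R.
Proof. by apply: ln_gt0; rewrite ltr1n. Qed.

Lemma log3_gt0 (R : realType) (x : R) : 1 < x -> 0 < log3 x.
Proof. by move=> x1; apply: divr_gt0; [exact: ln_gt0 | exact: ln3_gt0]. Qed.

Lemma log3_exp (R : realType) (x : R) (n : nat) :
  0 < x -> log3 (x ^+ n) = n%:R * log3 x.
Proof. by move=> x0; rewrite /log3 lnXn // mulr_natl mulrnAl. Qed.

(** Logarithms are taken in [3 ^ trunc_log 3 m <= m]. *)
Lemma trunc_log3_le_log3 (R : realType) (m : nat) :
  (0 < m)%N -> (trunc_log 3 m)%:R <= log3 m%:R :> R.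
Proof.
move=> m0; rewrite /log3 ler_pdivlMr ?ln3_gt0 // mulr_natl -lnXn ?ltr0n //.
by rewrite ler_ln ?posrE ?exprn_gt0 ?ltr0n // -natrX ler_nat trunc_logP.
Qed.

Lemma log_complexity_le_digit_sum (R : realType) (m : nat) (eps : R) :
  (1 < m)%N -> 3%:R + eps <= log_complexity R m ->
  eps * log3 m%:R <= (digit_sum 3 m)%:R.
Proof.
move=> m1; have m0 : (0 < m)%N by apply: ltnW.
rewrite /log_complexity ler_pdivlMr ?log3_gt0 ?ltr1n // mulrDl => epsm.
(* Adding [3 * log3 m] makes the left side [(3 + eps) * log3 m], which is at most [complexity m];
   the base 3 bound then finishes. *)
rewrite -(lerD2l (3%:R * log3 m%:R)) (le_trans epsm) //.
have := complexity_le_digit_sum 3 m isT.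
rewrite -(ler_nat R) natrD natrM => /le_trans; apply.
by rewrite lerD2r ler_wpM2l ?ler0n ?trunc_log3_le_log3.
Qed.

Theorem theorem1 (R : realType) (p : nat) (eps : R) (n : nat)
    (p_prime : prime p) (p_neq3 : p <> 3%N)
    (eps_gt0 : 0 < eps) (n_gt0 : (0 < n)%N)
    (complexity_ge : 3%:R + eps <= log_complexity R (p ^ n)%N) :
  n%:R * eps * log3 p%:R <= (digit_sum 3 (p ^ n)%N)%:R.
Proof.
have p1 := prime_gt1 p_prime.
have pn1 : (1 < p ^ n)%N by rewrite -(exp1n n) ltn_exp2r.
have := log_complexity_le_digit_sum _ _ _ pn1 complexity_ge.
(* The factor [n] comes from [log3 (p ^ n) = n * log3 p]. *)
by rewrite natrX log3_exp ?ltr0n ?prime_gt0 // mulrCA mulrA.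
Qed.
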